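(* Let $\mathcal{S}_3$ be the symmetric group on three letters. There exists a function $u\colon\mathcal{S}_3\to\mathbb{C}$ such that the Fourier multiplier $M_u\colon VN(\mathcal{S}_3)\to VN(\mathcal{S}_3)$ is unital and completely positive, but $M_u$ does not admit any absolute dilation.
   Context: A tracial von Neumann algebra $(M,\tau)$ is a von Neumann algebra $M$ with a normal semifinite faithful trace $\tau$. A positive map $J\colon(M_1,\tau_1)\to(M_2,\tau_2)$ between tracial von Neumann algebras is trace preserving if $\tau_2\circ J=\tau_1$ on $M_1^+$. If $J$ is a normal unital trace preserving $*$-homomorphism, it extends to an isometry $J_1\colon L^1(M_1,\tau_1)\to L^1(M_2,\tau_2)$, and, using $M_i\simeq L^1(M_i,\tau_i)^*$ via the pairing $\langle x,y\rangle=\tau_i(xy)$, one sets $\mathbb{E}_J=J_1^*\colon M_2\to M_1$ (the conditional expectation associated with $J$). An operator $T\colon\mathcal{M}\to\mathcal{M}$ on a tracial von Neumann algebra $(\mathcal{M},\tau_{\mathcal{M}})$ admits an absolute dilation if there exist a tracial von Neumann algebra $(M,\tau_M)$, a normal unital trace preserving $*$-homomorphism $J\colon\mathcal{M}\to M$ and a trace preserving $*$-automorphism $U\colon M\to M$ such that $T^k=\mathbb{E}_J U^k J$ for all integers $k\geq 0$. For a finite (more generally discrete) group $G$ with unit $e_G$, $\lambda\colon G\to B(\ell^2_G)$ is the left regular representation, $VN(G)\subseteq B(\ell^2_G)$ is the von Neumann algebra generated by $\{\lambda(t):t\in G\}$, equipped with the Plancherel trace $\tau_G$, i.e. the normal faithful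 tracial state with $\tau_G(\lambda(e_G))=1$ and $\tau_G(\lambda(s))=0$ for $s\neq e_G$. For $u\colon G\to\mathbb{C}$ with $G$ finite, $M_u\colon VN(G)\to VN(G)$ is the linear map with $M_u(\lambda(t))=u(t)\lambda(t)$ for all $t\in G$. *)

(* Defs.v *)
From HB Require Import structures.
From mathcomp Require Import all_boot all_order all_algebra all_fingroup.
From mathcomp Require Import ring sesquilinear complex.
From mathcomp Require Import all_classical all_reals ereal topology normedtype.

Set Implicit Arguments.
Unset Strict Implicit.
Unset Printing Implicit Defensive.

Import Order.TTheory GRing.Theory Num.Theory.
Import numFieldNormedType.Exports.

Local Open Scope classical_set_scope.
Local Open Scope ring_scope.
Local Open Scope complex_scope.

Record hilbertSpace (R : realType) := HilbertSpace {
  hcarrier :> completeNormedModType R[i] ;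
  hdot : {dot hcarrier for @Num.conj R[i]} ;
  hnormE : forall xi : hcarrier, `|xi| ^+ 2 = hdot xi xi }.
Arguments hdot {R} h.

Definition ell2 (R : realType) (G : finType) := {ffun G -> R[i]^o}.

Section Ell2.
Context (R : realType) (G : finType).
Local Notation C := R[i].
Local Notation L := (ell2 R G).
Implicit Types xi eta : L.

HB.instance Definition _ := Vector.on L.

Definition ell2_dot (xi eta : L) : C := \sum_s xi s * (eta s)^*%R.

Lemma ell2_dot_bilinear :
  bilinear_for ( *%R : GRing.Scale.law C C)
    (@Num.conj C \; *%R : GRing.Scale.law C C) ell2_dot.
Proof.
split=> [u' a x y|u a x y]; rewrite /ell2_dot /= mulr_sumr -big_split/=;
  apply: eq_bigr => s _; rewrite !ffunE.
  by rewrite mulrDl mulrA.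
by rewrite rmorphD rmorphM/= mulrDr mulrCA.
Qed.

HB.instance Definition _ := @bilinear_isBilinear.Build C L L C
  *%R (@Num.conj C \; *%R) ell2_dot ell2_dot_bilinear.

Lemma ell2_dot_herm xi eta :
  ell2_dot xi eta = (-1) ^+ false * (ell2_dot eta xi)^*%R.
Proof.
rewrite expr0 mul1r /ell2_dot rmorph_sum/=; apply: eq_bigr => s _.
by rewrite rmorphM/= conjCK mulrC.
Qed.

HB.instance Definition _ := @isHermitianSesquilinear.Build C L false
  (@Num.conj C) ell2_dot ell2_dot_herm.

Lemma ell2_dot_gt0 xi : xi != 0 -> 0 < ell2_dot xi xi.
Proof.
move=> xi0; have [s xis] : exists s, xi s != 0.
  apply/not_existsP => h; case/eqP: xi0; apply/ffunP => s; rewrite ffunE.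
  by have /negP/negbNE/eqP := h s.
rewrite /ell2_dot (bigD1 s)//= ltr_wpDr//.
  by apply: sumr_ge0 => t _; rewrite -normCK exprn_ge0.
by rewrite -normCK exprn_gt0// normr_gt0.
Qed.

HB.instance Definition _ := @isDotProduct.Build C L ell2_dot ell2_dot_gt0.

Local Notation dot := (ell2_dot : {dot L for @Num.conj C}).

Definition ell2_norm xi : C := sqrtC (ell2_dot xi xi).

Lemma ell2_dot_ge0 xi : 0 <= ell2_dot xi xi.
Proof. exact: (@dnorm_ge0 _ _ dot). Qed.

Lemma ell2_normD xi eta : ell2_norm (xi + eta) <= ell2_norm xi + ell2_norm eta.
Proof. exact: (triangle_lerif dot xi eta).1. Qed.

Lemma ell2_normZ (a : C) xi : ell2_norm (a *: xi) = `|a| * ell2_norm xi.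
Proof.
rewrite /ell2_norm (@dnormZ _ _ dot a xi) sqrtCM ?nnegrE ?exprn_ge0 ?ell2_dot_ge0//.
by rewrite exprCK.
Qed.

Lemma ell2_norm_eq0 xi : ell2_norm xi = 0 -> xi = 0.
Proof.
by move/eqP; rewrite /ell2_norm sqrtC_eq0 (@dnorm_eq0 _ _ dot xi) => /eqP.
Qed.

HB.instance Definition _ := @Lmodule_isNormed.Build C L ell2_norm
  ell2_normD ell2_normZ ell2_norm_eq0.

Lemma ell2_normE xi : `|xi| ^+ 2 = ell2_dot xi xi.
Proof. by rewrite sqrtCK. Qed.

Lemma ell2_coord_le xi s : `|xi s| <= `|xi|.
Proof.
rewrite -(@ler_pXn2r _ 2)// ?nnegrE// ell2_normE /ell2_dot (bigD1 s)//=.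
rewrite normCK lerDl; apply: sumr_ge0 => t _.
by rewrite -normCK exprn_ge0.
Qed.

Lemma ell2_norm_le xi : `|xi| <= \sum_s `|xi s|.
Proof.
have sum_ge0 : 0 <= \sum_s `|xi s| by apply: sumr_ge0.
rewrite -(@ler_pXn2r _ 2)// ?nnegrE// ell2_normE /ell2_dot.
rewrite [leRHS]expr2 mulr_suml; apply: ler_sum => s _.
rewrite -normCK expr2 ler_wpM2l//.
by rewrite (bigD1 s)//= lerDl; apply: sumr_ge0.
Qed.

Lemma ell2_complete (F : set_system L) : ProperFilter F -> cauchy F -> cvg F.
Proof.
move=> FF /cauchy_ballP Fc.
have coord_cvg (p : C -> R) s : (forall z z', p (z - z') = p z - p z') ->
    (forall z, `|p z|%:C <= `|z|) -> cvg ((fun xi : L => p (xi s)) @ F).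
  move=> pB ple; apply: (@cauchy_cvg R); apply/cauchy_ballP => e e0.
  have e0' : 0 < e%:C by rewrite ltcR.
  have [[A B] /= [FA FB] AB] := Fc _ e0'.
  rewrite near_map2; exists (A, B) => //= -[x y] /= [Ax By].
  have xy : `|x - y| < e%:C by exact: (AB (x, y)).
  suff : `|p (x s) - p (y s)| < e by [].
  rewrite -pB -ltcR.
  apply: le_lt_trans xy; apply: (@le_trans _ _ `|(x - y) s|).
    by rewrite !ffunE; exact: ple.
  exact: ell2_coord_le.
have Re_cvg s := coord_cvg (@complex.Re R) s (raddfB (@complex.Re R))
  (@complex.normc_ge_Re R).
have Im_cvg s : cvg ((fun xi : L => complex.Im (xi s)) @ F).
  apply: coord_cvg => [z z'|z]; first exact: raddfB.
  have := complex.normc_ge_Re (z * 'i%C); rewrite ReiNIm normrN => /le_trans; apply.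
  by rewrite normrM complexiE normCi mulr1.
pose l : L := [ffun s => (lim ((fun xi : L => complex.Re (xi s)) @ F) +i*
                          lim ((fun xi : L => complex.Im (xi s)) @ F))%C].
apply/cvg_ex; exists l.
apply/cvgrPdist_lt => e e0.
have [r er] : exists r, e = r%:C by apply/complex_realP; exact: gtr0_real.
have r0 : 0 < r by rewrite -ltcR -er.
pose d := r / 2 / #|G|.+1%:R.
have d0 : 0 < d by rewrite !divr_gt0.
have near_l : \forall xi \near F, forall s, `|(l - xi) s| <= (d + d)%:C.
  apply: filter_forall => s.
  have /cvgrPdist_lt/(_ _ d0) := Re_cvg s.
  have /cvgrPdist_lt/(_ _ d0) := Im_cvg s.
  apply: filterS2 => xi im_lt re_lt; rewrite !ffunE.
  set z := (X in `|X|).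
  have -> : z = (complex.Re z)%:C + 'i%C * (complex.Im z)%:C by rewrite -complexE.
  rewrite (le_trans (ler_normD _ _))// rmorphD/= lerD//.
    rewrite normc_def/= expr0n addr0 sqrtr_sqr lecR ltW//.
    by rewrite raddfB.
  rewrite normrM complexiE normCi mul1r normc_def/= expr0n addr0 sqrtr_sqr lecR ltW//.
  by rewrite raddfB.
apply: filterS near_l => xi lxi.
apply: le_lt_trans (ell2_norm_le _) _.
apply: (@le_lt_trans _ _ (\sum_(s : G) (d + d)%:C)); first exact: ler_sum.
rewrite sumr_const er -rmorphMn/= ltcR.
have -> : d + d = r / #|G|.+1%:R by rewrite /d -mulrDl -splitr.
by rewrite -mulr_natr -mulrA gtr_pMr// mulrC ltr_pdivrMr// mul1r ltr_nat.
Qed.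

HB.instance Definition _ := Uniform_isComplete.Build L ell2_complete.

Definition ell2_hilbert : hilbertSpace R :=
  @HilbertSpace R L (ell2_dot : {dot L for @Num.conj C}) ell2_normE.

End Ell2.

Section Operators.
Context (R : realType) (H : hilbertSpace R).
Implicit Types (x y z : H -> H) (S M : set (H -> H)).

Definition bounded_op x :=
  linear x /\ exists K : R[i], forall xi, `|x xi| <= K * `|xi|.

Definition is_adjoint x y :=
  forall xi eta, hdot H (x xi) eta = hdot H xi (y eta).

Definition positive_op x := forall xi, 0 <= hdot H (x xi) xi.

Definition le_op x y := positive_op (y - x).

Definition commutant S : set (H -> H) :=
  [set y | bounded_op y /\ forall x, S x -> x \o y = y \o x].

Record is_vonNeumann M : Prop := IsVonNeumann {
  vN_adjoint : forall x, M x -> exists2 y, M y & is_adjoint x y ;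
  vN_bicommutant : commutant (commutant M) = M }.

Definition positive_part M : set (H -> H) := [set x | M x /\ positive_op x].

Definition directed S :=
  S !=set0 /\
  forall x y, S x -> S y -> exists z, [/\ S z, le_op x z & le_op y z].

(* Least upper bound in the self-adjoint part of M: operators dominating a
   positive one are self-adjoint. *)
Definition is_lub M S x :=
  [/\ M x, forall y, S y -> le_op y x &
      forall z, M z -> (forall y, S y -> le_op y z) -> le_op x z].

(* A trace is a function on the positive part; its values elsewhere are
   irrelevant. *)
Record is_nsf_trace M (tau : (H -> H) -> \bar R) : Prop := IsNsfTrace {
  trace_ge0 : forall x, positive_part M x -> (0 <= tau x)%E ;
  traceD : forall x y, positive_part M x -> positive_part M y ->
    tau (x + y) = (tau x + tau y)%E ;
  traceZ : forall (a : R) x, 0 <= a -> positive_part M x ->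
    tau (a%:C *: x) = (a%:E * tau x)%E ;
  trace_cyclic : forall x y, M x -> is_adjoint x y ->
    tau (y \o x) = tau (x \o y) ;
  trace_normal : forall S x, S `<=` positive_part M -> directed S ->
    is_lub M S x -> tau x = ereal_sup (tau @` S) ;
  trace_semifinite : forall x, positive_part M x -> x <> 0 ->
    exists y, [/\ positive_part M y, y <> 0, le_op y x & (tau y < +oo)%E] ;
  trace_faithful : forall x, positive_part M x -> tau x = 0%E -> x = 0 }.

(* Positivity in M_n(B(H)) = B(H^n). *)
Definition positive_mx n (x : 'M[H -> H]_n) :=
  forall xi : 'I_n -> H, 0 <= \sum_i \sum_j hdot H (x i j (xi j)) (xi i).

Definition completely_positive M (T : (H -> H) -> (H -> H)) :=
  forall n (x : 'M[H -> H]_n), (forall i j, M (x i j)) ->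
  positive_mx x -> positive_mx (map_mx T x).

End Operators.

Record tracialVNA (R : realType) := TracialVNA {
  tspace : hilbertSpace R ;
  tcarrier :> set (tspace -> tspace) ;
  ttrace : (tspace -> tspace) -> \bar R ;
  tcarrierP : is_vonNeumann tcarrier ;
  ttraceP : is_nsf_trace tcarrier ttrace }.

Arguments tcarrier {R} t.

Notation op M := (tspace M -> tspace M).

(* x belongs to the definition ideal of the trace (the linear span of the
   positive elements of finite trace, a dense subspace of L^1) and c is the
   value at x of the linear extension of the trace. *)
Definition has_trace (R : realType) (M : tracialVNA R) (x : op M) (c : R[i]) :=
  exists a : 'I_4 -> op M,
  [/\ forall k, positive_part M (a k) /\ (ttrace (a k) < +oo)%E,
      x = \sum_(k < 4) ('i ^+ k : R[i]) *: a k &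
      c = \sum_(k < 4) 'i ^+ k * (fine (ttrace (a k)))%:C].

Section Dilation.
Context (R : realType).
Implicit Types (M N : tracialVNA R).

Record star_hom N M (J : op N -> op M) : Prop := StarHom {
  star_hom_in : forall x, tcarrier N x -> tcarrier M (J x) ;
  star_homD : forall x y, tcarrier N x -> tcarrier N y ->
    J (x + y) = J x + J y ;
  star_homZ : forall (a : R[i]) x, tcarrier N x -> J (a *: x) = a *: J x ;
  star_homM : forall x y, tcarrier N x -> tcarrier N y ->
    J (x \o y) = J x \o J y ;
  star_hom_adj : forall x y, tcarrier N x -> tcarrier N y -> is_adjoint x y ->
    is_adjoint (J x) (J y) }.

Definition normal_map N M (J : op N -> op M) :=
  forall (S : set (op N)) x, S `<=` positive_part N -> directed S ->
  is_lub N S x -> is_lub M (J @` S) (J x).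

Definition trace_preserving N M (J : op N -> op M) :=
  forall x, positive_part N x -> ttrace (J x) = ttrace x.

Definition unital N M (J : op N -> op M) := J idfun = idfun.

(* E is the adjoint of the isometry J_1 : L^1(N) -> L^1(M) extending J, for the
   pairing tau(x y) of an algebra with its L^1 space. The adjunction is tested
   on the definition ideal of the trace of N, which is dense in L^1(N) and on
   which J_1 = J (it is all of L^1(N) when N is finite dimensional). *)
Definition is_cond_exp N M (J : op N -> op M) (E : op M -> op N) :=
  (forall y, tcarrier M y -> tcarrier N (E y)) /\
  forall y x a, tcarrier M y -> has_trace x a ->
    exists2 c, has_trace (E y \o x) c & has_trace (y \o J x) c.

Definition admits_absolute_dilation N (T : op N -> op N) :=
  exists (M : tracialVNA R) (J : op N -> op M) (U : op M -> op M)
         (E : op M -> op N),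
  [/\ [/\ star_hom J, normal_map J, unital J & trace_preserving J],
      [/\ star_hom U, set_bij M M U & trace_preserving U],
      is_cond_exp J E &
      forall k x, tcarrier N x -> iter k T x = E (iter k U (J x))].

End Dilation.

Section GroupVNA.
Context (R : realType) (G : finGroupType).
Local Notation C := R[i].
Local Notation H := (ell2_hilbert R G).
Local Notation L := (ell2 R G).
Implicit Types (x y : H -> H) (xi : L) (s t : G).

Definition lambda (t : G) (xi : H) : H :=
  [ffun s : G => (xi : L) (t^-1 * s)%g].

Definition delta (t : G) : H := [ffun s : G => (s == t)%:R].

Definition VN_carrier : set (H -> H) := commutant (commutant (range lambda)).

(* The vector state at delta 1; it satisfies has_trace_lambda below. *)
Definition VN_trace x : \bar R :=
  (complex.Re (hdot H (x (delta 1%g)) (delta 1%g)))%:E.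

(* The coefficient of x on lambda t, for x in VN(G): see VNE. *)
Definition coef x (t : G) : C := (x (delta 1%g) : L) t.

End GroupVNA.

Section GroupVNATheory.
Context (R : realType) (G : finGroupType).
Local Notation C := R[i].
Local Notation H := (ell2_hilbert R G).
Local Notation L := (ell2 R G).
Local Notation dot := (@ell2_dot R G : {dot L for @Num.conj C}).
Implicit Types (x y : H -> H) (xi : L) (s t : G).

Lemma lin_sum (V W : lmodType R[i]) (x : V -> W) (I : finType) (a : I -> R[i])
  (f : I -> V) : linear x ->
  x (\sum_i a i *: f i) = \sum_i a i *: x (f i).
Proof.
move=> xlin.
pose X : {linear V -> W} := HB.pack x (GRing.isLinear.Build _ _ _ _ x xlin).
rewrite -[x]/(X : V -> W) raddf_sum; apply: eq_bigr => i _; exact: linearZ.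
Qed.

Lemma lin0 (V W : lmodType R[i]) (x : V -> W) : linear x -> x 0 = 0.
Proof.
by move=> xlin; have := xlin (-1) 0 0; rewrite scaler0 addr0 scaleN1r addNr.
Qed.

Lemma linD (V W : lmodType R[i]) (x : V -> W) u v : linear x -> x (u + v) = x u + x v.
Proof.
by move=> xlin; have := xlin 1 u v; rewrite !scale1r.
Qed.

Lemma linZ (V W : lmodType R[i]) (x : V -> W) (a : C) u : linear x -> x (a *: u) = a *: x u.
Proof.
by move=> xlin; have := xlin a u 0; rewrite !addr0 lin0// addr0.
Qed.

Lemma deltaE xi : xi = \sum_s xi s *: (delta R s : L).
Proof.
apply/ffunP => t; rewrite sum_ffunE (bigD1 t)//= big1 ?addr0; last first.
  by move=> s st; rewrite !ffunE eq_sym (negbTE st) scaler0.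
by rewrite !ffunE eqxx [RHS]mulr1.
Qed.

Lemma bounded_ell2 x : linear x -> bounded_op x.
Proof.
move=> xlin; split=> //; exists (\sum_s `|x (delta R s)|) => xi.
rewrite [in leLHS](deltaE xi) lin_sum//.
apply: (le_trans (ler_norm_sum _ _ _)).
rewrite mulr_suml; apply: ler_sum => s _.
by rewrite normrZ mulrC ler_wpM2l//; exact: ell2_coord_le.
Qed.

Local Notation VN := (@VN_carrier R G).

Lemma lambda_lin t : linear (lambda t : H -> H).
Proof. by move=> a u v; apply/ffunP => s; rewrite !ffunE. Qed.

Definition rho (t : G) (xi : H) : H := [ffun s : G => (xi : L) (s * t)%g].

Lemma rho_lin t : linear (rho t).
Proof. by move=> a u v; apply/ffunP => s; rewrite !ffunE. Qed.

Lemma lambda_delta s t : lambda s (delta R t) = delta R (s * t)%g.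
Proof.
apply/ffunP => r; rewrite !ffunE; congr (_%:R); congr nat_of_bool.
by rewrite -(inj_eq (mulgI s)) mulKVg.
Qed.

Lemma rho_delta s t : rho s (delta R t) = delta R (t * s^-1)%g.
Proof.
apply/ffunP => r; rewrite !ffunE; congr (_%:R); congr nat_of_bool.
by rewrite -(inj_eq (mulIg s^-1%g)) mulgK.
Qed.

Lemma lambda_rho s t : (lambda s : H -> H) \o rho t = rho t \o lambda s.
Proof. by apply/funext => xi; apply/ffunP => r; rewrite !ffunE mulgA. Qed.

Lemma VN_linear x : VN x -> linear x. Proof. by case=> -[]. Qed.

Lemma VN_delta x s t : VN x -> (x (delta R t) : L) s = coef x (s * t^-1)%g.
Proof.
move=> [_ xC]; have /(congr1 (fun y => y (delta R 1%g))) /= : rho t^-1%g \o x = x \o rho t^-1%g.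
  apply: xC; split; first exact/bounded_ell2/rho_lin.
  by move=> _ [r _ <-]; exact: lambda_rho.
by rewrite rho_delta invgK mul1g => <-; rewrite ffunE.
Qed.

Lemma ext_ell2 x y : linear x -> linear y ->
  (forall t, x (delta R t) = y (delta R t)) -> x = y.
Proof.
move=> xl yl xy; apply/funext => xi; rewrite (deltaE xi) !lin_sum//.
by apply: eq_bigr => s _; rewrite xy.
Qed.

Lemma sum_opE (I : finType) (a : I -> C) (f : I -> H -> H) xi :
  (\sum_i a i *: f i) xi = \sum_i a i *: f i xi.
Proof. by rewrite fct_sumE. Qed.

Lemma commutant_sum (S : set (H -> H)) (I : finType) (a : I -> C) (f : I -> H -> H) :
  (forall z, S z -> linear z) ->
  (forall i, commutant S (f i)) -> commutant S (\sum_i a i *: f i).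
Proof.
move=> Sl Sf; split.
  apply: bounded_ell2 => b u v; rewrite !sum_opE scaler_sumr -big_split/=.
  apply: eq_bigr => i _; have [[fl _] _] := Sf i.
  by rewrite fl scalerDr !scalerA mulrC.
move=> z Sz; apply/funext => xi /=; rewrite !sum_opE lin_sum; last exact: Sl.
apply: eq_bigr => i _; congr (_ *: _).
by have [_ /(_ _ Sz)/(congr1 (fun y => y xi))] := Sf i.
Qed.

Lemma commutant_linear (S : set (H -> H)) z : commutant S z -> linear z.
Proof. by case=> -[]. Qed.

Lemma VN_lambda t : VN (lambda t).
Proof.
split; first exact/bounded_ell2/lambda_lin.
by move=> z [_ zC]; rewrite zC//; exists t.
Qed.

Lemma VN_sum (I : finType) (a : I -> C) (f : I -> H -> H) :
  (forall i, VN (f i)) -> VN (\sum_i a i *: f i).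
Proof. by apply: commutant_sum => z; exact: commutant_linear. Qed.

Lemma coef_sum (a : G -> C) s : coef (\sum_t a t *: lambda t) s = a s.
Proof.
rewrite /coef sum_opE sum_ffunE (bigD1 s)//= big1 ?addr0 => [|t ts].
  by rewrite ffunE lambda_delta mulg1 ffunE eqxx [LHS]mulr1.
by rewrite ffunE lambda_delta mulg1 ffunE eq_sym (negbTE ts) scaler0.
Qed.

Lemma VNE x : VN x -> x = \sum_t coef x t *: lambda t.
Proof.
move=> Vx.
have Vs : VN (\sum_t coef x t *: lambda t) by apply: VN_sum => t; exact: VN_lambda.
apply: ext_ell2; [exact: VN_linear..|] => t; apply/ffunP => s.
by rewrite !VN_delta// coef_sum.
Qed.

Lemma hdotE (u v : H) : hdot H u v = ell2_dot (u : L) (v : L).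
Proof. by []. Qed.

Lemma is_adjoint_sum x (a : G -> C) : x = \sum_t a t *: lambda t ->
  is_adjoint x (\sum_t (a t)^*%R *: lambda t^-1%g).
Proof.
move=> -> xi eta; rewrite !hdotE.
rewrite !sum_opE (linear_sumlz dot) (linear_sumr dot)/=; apply: eq_bigr => t _.
rewrite (linearZl_LR dot) (linearZr_LR dot)/= conjCK; congr (_ * _).
rewrite /ell2_dot (reindex_inj (mulgI t))/=; apply: eq_bigr => s _.
by rewrite !ffunE mulKg invgK.
Qed.

Lemma VN_is_vonNeumann : is_vonNeumann VN.
Proof.
split.
  move=> x Vx; exists (\sum_t (coef x t)^*%R *: lambda t^-1%g).
    by apply: VN_sum => t; exact: VN_lambda.
  exact/is_adjoint_sum/VNE.
have anti (S S' : set (H -> H)) : S `<=` S' -> commutant S' `<=` commutant S.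
  by move=> SS' y [yb yC]; split=> // x /SS'; exact: yC.
have sub (S : set (H -> H)) : (forall x, S x -> bounded_op x) ->
    S `<=` commutant (commutant S).
  move=> Sb x Sx; split; first exact: Sb.
  by move=> y [_ yC]; rewrite yC.
apply/seteqP; split; last by apply: sub => x [].
apply: (anti); apply: sub => x; by case.
Qed.

Lemma VN_traceE x : VN_trace x = (complex.Re (coef x 1%g))%:E.
Proof.
rewrite /VN_trace hdotE /ell2_dot (bigD1 1%g)//= big1 ?addr0.
  by rewrite ffunE eqxx conjC1 mulr1.
by move=> s s1; rewrite ffunE (negbTE s1) conjC0 mulr0.
Qed.

Lemma dot_delta (u : L) t : ell2_dot u (delta R t) = u t.
Proof.
rewrite /ell2_dot (bigD1 t)//= big1 ?addr0.
  by rewrite ffunE eqxx conjC1 mulr1.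
by move=> s s1; rewrite ffunE (negbTE s1) conjC0 mulr0.
Qed.

Lemma coefB x y t : coef (y - x) t = coef y t - coef x t.
Proof. by rewrite /coef !fctE !ffunE. Qed.

Lemma coef1_ge0 x : positive_op x -> 0 <= coef x 1%g.
Proof. by move=> /(_ (delta R 1%g)); rewrite hdotE dot_delta. Qed.

Lemma coef_bound x t : VN x -> positive_op x -> `|coef x t| <= coef x 1%g *+ 2.
Proof.
move=> Vx x0.
have xl := VN_linear Vx.
pose p := coef x t; pose q := coef x t^-1%g; pose d := coef x 1%g.
have d0 : 0 <= d := coef1_ge0 x0.
have form (w : C) : w^*%R * w = 1 -> 0 <= d *+ 2 + (w^*%R * p + w * q).
  move=> w1.
  have := x0 ((delta R 1%g : L) + w *: (delta R t : L)).
  rewrite hdotE.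
  have -> : x ((delta R 1%g : L) + w *: (delta R t : L)) = (x (delta R 1%g) : L) + w *: (x (delta R t) : L).
    by rewrite linD// linZ.
  rewrite (linearDl dot) !(linearDr dot)/= (linearZl_LR dot).
  rewrite !(linearZr_LR dot)/= !dot_delta.
  have -> : (w *: (x (delta R t) : L)) t = w * (x (delta R t) : L) t.
    by rewrite ffunE.
  rewrite !VN_delta// !mulgV invg1 !mulg1 mul1g -/p -/q -/d mulrA w1 mul1r.
  by rewrite [w * q + d]addrC addrACA -mulr2n.
have normle (e : C) : 0 <= d *+ 2 + e -> 0 <= d *+ 2 - e -> `|e| <= d *+ 2.
  move=> h1 h2; have er : e \is Num.real.
    have -> : e = (d *+ 2 + e) - d *+ 2 by rewrite addrC addKr.
    by rewrite rpredB// ger0_real// mulrn_wge0.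
  rewrite real_ler_norml//; apply/andP; split; last by rewrite -subr_ge0.
  by rewrite lerNl -subr_ge0 opprK.
have pq : `|p + q| <= d *+ 2.
  apply: normle; first by have := form 1; rewrite conjC1 !mul1r; apply.
  have := form (-1); rewrite rmorphN1 mulrNN mulr1 !mulN1r -opprD.
  exact.
have qp : `|q - p| <= d *+ 2.
  have i0 : 'i%C * 'i%C = -1 :> C by rewrite -expr2 sqr_i.
  have ic : ('i%C : C)^*%R = - 'i%C by rewrite complexiE conjCi.
  have -> : `|q - p| = `|- 'i%C * p + 'i%C * q|.
    by rewrite mulNr [- _ + _]addrC -mulrBr normrM complexiE normCi mul1r.
  apply: normle.
    by have := form 'i%C; rewrite ic mulNr i0 opprK; apply.
  have icN : (- 'i%C : C)^*%R = 'i%C by rewrite -ic conjCK.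
  have := form (- 'i%C); rewrite icN mulrN i0 opprK opprD !mulNr opprK.
  exact.
have : `|p *+ 2| <= d *+ 2 *+ 2.
  have -> : p *+ 2 = (p + q) - (q - p) by rewrite opprB addrACA subrr addr0 mulr2n.
  by rewrite (le_trans (ler_normB _ _))// [leRHS]mulr2n lerD.
by rewrite normrMn lerMn2r.
Qed.

Lemma lambda1 : lambda 1%g = idfun :> (H -> H).
Proof. by apply/funext => xi; apply/ffunP => s; rewrite ffunE invg1 mul1g. Qed.

Lemma VN_id : VN idfun. Proof. by rewrite -lambda1; exact: VN_lambda. Qed.

Lemma VNZ (a : C) x : VN x -> VN (a *: x).
Proof.
move=> Vx; have -> : a *: x = \sum_(i < 1) (fun=> a) i *: (fun=> x) i.
  by rewrite big_ord1.
by apply: VN_sum.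
Qed.

Lemma VND x y : VN x -> VN y -> VN (x + y).
Proof.
move=> Vx Vy.
have -> : x + y = \sum_(b : bool) (fun=> 1 : C) b *: (if b then x else y).
  by rewrite big_bool/= !scale1r.
by apply: VN_sum => -[].
Qed.

Lemma coefZ (a : C) x t : coef (a *: x) t = a * coef x t.
Proof. by rewrite /coef !fctE !ffunE. Qed.

Lemma coefD x y t : coef (x + y) t = coef x t + coef y t.
Proof. by rewrite /coef !fctE !ffunE. Qed.

Lemma coef_id t : coef (idfun : H -> H) t = (t == 1%g)%:R.
Proof. by rewrite /coef /= ffunE. Qed.

Lemma dot_lambda_le (xi : L) t : `|ell2_dot (lambda t xi : L) xi| <= ell2_dot xi xi.
Proof.
rewrite -(@ler_pXn2r _ 2)// ?nnegrE ?ell2_dot_ge0//.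
apply: (le_trans (CauchySchwarz dot (lambda t xi : L) xi).1) => /=.
rewrite expr2 ler_wpM2r ?ell2_dot_ge0// le_eqVlt; apply/orP; left; apply/eqP.
rewrite /ell2_dot (reindex_inj (mulgI t))/=; apply: eq_bigr => s _.
by rewrite !ffunE mulKg.
Qed.

Lemma positive_le_id x : VN x -> positive_op x ->
  le_op x ((coef x 1%g *+ 2 *+ #|G|) *: idfun).
Proof.
move=> Vx x0 xi; rewrite hdotE.
have -> : ((coef x 1%g *+ 2 *+ #|G|) *: idfun - x) xi =
  (coef x 1%g *+ 2 *+ #|G|) *: (xi : L) - (x xi : L) by [].
rewrite (linearBl dot) (linearZl_LR dot)/= subr_ge0.
rewrite -[leLHS]ger0_norm; last by have := x0 xi; rewrite hdotE.
rewrite [in leLHS](VNE Vx) sum_opE (linear_sumlz dot)/=.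
apply: (le_trans (ler_norm_sum _ _ _)).
rewrite -sumr_const mulr_suml; apply: ler_sum => t _.
rewrite (linearZl_LR dot)/= normrM.
by rewrite ler_pM// ?coef_bound// dot_lambda_le.
Qed.

Lemma coef1_real x : positive_op x -> (complex.Re (coef x 1%g))%:C = coef x 1%g.
Proof. by move=> /coef1_ge0 x0; apply/RRe_real/ger0_real. Qed.

Lemma le_op_trace x y : le_op x y -> (VN_trace x <= VN_trace y)%E.
Proof.
move=> /coef1_ge0; rewrite coefB subr_ge0 lecE => /andP[_ xy].
by rewrite !VN_traceE lee_fin.
Qed.

Lemma VN_trace_fin x : VN_trace x \is a fin_num.
Proof. by rewrite VN_traceE. Qed.

Lemma VN_traceD x y : VN_trace (x + y) = (VN_trace x + VN_trace y)%E.
Proof. by rewrite !VN_traceE coefD -EFinD raddfD. Qed.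

Lemma VN_traceZ (a : R) x : VN_trace (a%:C *: x) = (a%:E * VN_trace x)%E.
Proof.
rewrite !VN_traceE coefZ -EFinM; congr (_%:E).
by case: (coef x _) => u v /=; rewrite mul0r subr0.
Qed.

Lemma VN_trace_cyclic x y : VN x -> is_adjoint x y ->
  VN_trace (y \o x) = VN_trace (x \o y).
Proof.
move=> Vx xy.
have xe : x (delta R 1%g) = [ffun s => coef x s] by apply/ffunP => s; rewrite ffunE.
have ye : y (delta R 1%g) = [ffun s => (coef x s^-1)^*%R].
  apply/ffunP => s; rewrite ffunE -dot_delta -[LHS]conjCK; congr (_^*%R).
  have := ell2_dot_herm (delta R s : L) (y (delta R 1%g) : L).
  rewrite expr0 mul1r => <-.
  have := xy (delta R s) (delta R 1%g); rewrite !hdotE => <-.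
  by rewrite dot_delta VN_delta// mul1g.
rewrite /VN_trace; congr ((complex.Re _)%:E).
have -> : hdot H ((x \o y) (delta R 1%g)) (delta R 1%g) =
    ell2_dot (y (delta R 1%g) : L) (y (delta R 1%g) : L).
  by have := xy (y (delta R 1%g)) (delta R 1%g); rewrite !hdotE.
have -> : hdot H ((y \o x) (delta R 1%g)) (delta R 1%g) =
    ell2_dot (x (delta R 1%g) : L) (x (delta R 1%g) : L).
  rewrite hdotE ell2_dot_herm expr0 mul1r.
  have := xy (delta R 1%g) (x (delta R 1%g)); rewrite !hdotE => <-.
  by have := ell2_dot_herm (x (delta R 1%g) : L) (x (delta R 1%g) : L); rewrite expr0 mul1r.
rewrite xe ye /ell2_dot [RHS](reindex_inj invg_inj)/=; apply: eq_bigr => s _.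
by rewrite !ffunE invgK conjCK mulrC.
Qed.

Lemma VN_trace_faithful x : positive_part VN x -> VN_trace x = 0%E -> x = 0.
Proof.
move=> [Vx x0]; rewrite VN_traceE => -[tr0].
have c0 : coef x 1%g = 0 by rewrite -coef1_real// tr0.
rewrite (VNE Vx) big1// => t _; have := coef_bound t Vx x0.
by rewrite c0 mul0rn normr_le0 => /eqP ->; rewrite scale0r.
Qed.

Lemma regroup (V : zmodType) (u v w p q : V) :
  (u + p) - w = (q - (v - u)) + (v - w) + (p - q).
Proof.
rewrite opprB -[q + (u - v) + _]addrA [u - v + _]addrA subrK.
by rewrite [RHS]addrC addrA subrK addrA [p + u]addrC.
Qed.

Lemma VN_trace_normal (S : set (H -> H)) x : S `<=` positive_part VN ->
  directed S -> is_lub VN S x -> VN_trace x = ereal_sup (@VN_trace R G @` S).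
Proof.
move=> SV [[x0 Sx0] Sdir] [Vx Sx xmin].
apply/eqP; rewrite eq_le; apply/andP; split; last first.
  by apply: ge_ereal_sup => _ [y Sy <-]; exact/le_op_trace/Sx.
have supfin : ereal_sup (@VN_trace R G @` S) \is a fin_num.
  rewrite fin_real//; apply/andP; split.
    apply: (@lt_le_trans _ _ (VN_trace x0)); first by rewrite VN_traceE ltNyr.
    by apply: ereal_sup_ubound; exists x0.
  apply: (@le_lt_trans _ _ (VN_trace x)); last by rewrite VN_traceE ltry.
  by apply: ge_ereal_sup => _ [y Sy <-]; exact/le_op_trace/Sx.
rewrite VN_traceE -(fineK supfin) lee_fin; set r := fine _.
pose T (y : H -> H) : R := complex.Re (coef y 1%g); rewrite -/(T x).
have Tr y : S y -> T y <= r.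
  move=> Sy; rewrite -lee_fin fineK// -VN_traceE.
  by apply: ereal_sup_ubound; exists y.
have Tmono y z : le_op y z -> T y <= T z.
  by move=> /le_op_trace; rewrite !VN_traceE lee_fin.
pose K : R := #|G|.*2.+1%:R.
have K0 : 0 < K by [].
apply/ler_addgt0Pr => e e0; pose d := e / K.
have d0 : 0 < d by rewrite divr_gt0.
have [_ [a Sa <-]] := ub_ereal_sup_adherent d0 supfin.
rewrite VN_traceE -(fineK supfin) -/r -EFinB lte_fin -/(T a) => ra.
have [Va a0] := SV _ Sa.
pose z : H -> H := a + (d%:C *+ 2 *+ #|G|) *: idfun.
have Vz : VN z by apply: VND => //; apply: VNZ; exact: VN_id.
have zub y : S y -> le_op y z.
  move=> Sy; have [c [Sc ac yc]] := Sdir _ _ Sa Sy.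
  have Vca : VN (c - a).
    by rewrite -scaleN1r; apply: VND; [have [] := SV _ Sc|exact: VNZ].
  have := positive_le_id Vca ac; set k := (X in X *: idfun) => cak.
  have kle : 0 <= d%:C *+ 2 *+ #|G| - k.
    rewrite subr_ge0 /k !lerMn2r; apply/orP; right => /=.
    rewrite -coef1_real// lecR coefB raddfB/= -/(T c) -/(T a) lerBlDr.
    by rewrite (le_trans (Tr _ Sc))// -lerBlDl ltW.
  move=> xi; rewrite hdotE.
  have -> : (z - y) xi = (((k *: idfun - (c - a)) xi : L) + ((c - y) xi : L)) +
      (d%:C *+ 2 *+ #|G| - k) *: (xi : L).
    rewrite scalerBl; exact: regroup.
  rewrite (linearDl dot)/= addr_ge0//; last first.
    by rewrite (linearZl_LR dot)/= mulr_ge0// ell2_dot_ge0.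
  rewrite (linearDl dot)/= addr_ge0//.
    by have := cak xi; rewrite hdotE.
  by have := yc xi; rewrite hdotE.
apply: (le_trans (Tmono _ _ (xmin _ Vz zub))).
rewrite /T coefD coefZ coef_id eqxx mulr1 raddfD/= !raddfMn/= -mulrnA -/(T a).
rewrite lerD ?Tr// /d -mulr_natr mulrAC ler_pdivrMr// ler_wpM2l ?(ltW e0)//.
by rewrite /K ler_nat mul2n.
Qed.

Lemma VN_is_nsf_trace : is_nsf_trace VN (@VN_trace R G).
Proof.
split.
- by move=> x [_ /coef1_ge0]; rewrite VN_traceE lee_fin lecE => /andP[].
- by move=> x y _ _; exact: VN_traceD.
- by move=> a x _ _; exact: VN_traceZ.
- exact: VN_trace_cyclic.
- exact: VN_trace_normal.
- move=> x Vx x0; exists x; split=> //; last by rewrite VN_traceE ltry.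
  by move=> xi; rewrite subrr hdotE (linear0l dot).
- exact: VN_trace_faithful.
Qed.

Definition VN_alg : tracialVNA R := TracialVNA VN_is_vonNeumann VN_is_nsf_trace.

Lemma coef_lambda s t : coef (lambda s : H -> H) t = (t == s)%:R.
Proof. by rewrite /coef lambda_delta mulg1 ffunE. Qed.

Lemma coef_inj x y : VN x -> VN y -> (forall t, coef x t = coef y t) -> x = y.
Proof.
move=> Vx Vy xy; rewrite (VNE Vx) (VNE Vy).
by apply: eq_bigr => t _; rewrite xy.
Qed.

Lemma coef_sumE (I : finType) (c : I -> C) (f : I -> H -> H) t :
  coef (\sum_i c i *: f i) t = \sum_i c i * coef (f i) t.
Proof.
by rewrite /coef sum_opE sum_ffunE; apply: eq_bigr => i _; rewrite ffunE.
Qed.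

Lemma has_trace_lambda s : has_trace (M := VN_alg) (lambda s) (s == 1%g)%:R.
Proof.
pose a (k : 'I_4) : H -> H :=
 4^-1 *: (2 *: idfun + 'i%C ^+ k *: lambda s^-1%g + (- 'i%C) ^+ k *: lambda s).
have icjE k : ('i%C ^+ k : C)^*%R = (- 'i%C) ^+ k.
  by rewrite rmorphXn/= complexiE conjCi.
have apos k : positive_part VN (a k).
  split.
    by apply/VNZ/VND; [apply: VND|]; apply: VNZ; [exact: VN_id|exact: VN_lambda..].
  move=> xi; rewrite hdotE.
  pose w : L := (lambda s xi : L) + 'i%C ^+ k *: (xi : L).
  suff -> : ell2_dot (a k xi : L) xi = 4^-1 * ell2_dot w w.
    by rewrite mulr_ge0// ?invr_ge0// ell2_dot_ge0.
  have -> : a k xi = 4^-1 *: (2 *: (xi : L) +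
      'i%C ^+ k *: (lambda s^-1%g xi : L) + (- 'i%C) ^+ k *: (lambda s xi : L)) by [].
  rewrite /w (linearZl_LR dot) !(linearDl dot) !(linearZl_LR dot)/= !(linearDr dot)/=.
  rewrite !(linearZr_LR dot)/=.
  have -> : ell2_dot (lambda s xi : L) (lambda s xi : L) = ell2_dot (xi : L) (xi : L).
    rewrite /ell2_dot (reindex_inj (mulgI s))/=; apply: eq_bigr => r _.
    by rewrite !ffunE mulKg.
  have -> : ell2_dot (lambda s^-1%g xi : L) (xi : L) = ell2_dot (xi : L) (lambda s xi : L).
    rewrite /ell2_dot [RHS](reindex_inj (mulgI s))/=; apply: eq_bigr => r _.
    by rewrite !ffunE invgK mulKg.
  have icj1 : 'i%C ^+ k * (- 'i%C) ^+ k = 1 :> C.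
    by rewrite -exprMn mulrN -expr2 sqr_i opprK expr1n.
  congr (_ * _); rewrite icjE.
  rewrite [X in _ = _ + _ * _ + X]mulrDr [_ * (_ * ell2_dot xi xi)]mulrA icj1.
  ring.
have asum : lambda s = \sum_(k < 4) 'i%C ^+ k *: a k.
  apply: coef_inj; first exact: VN_lambda.
    by apply: VN_sum => k; have [] := apos k.
  move=> t; rewrite coef_lambda coef_sumE.
  set r : C := (t == s)%:R.
  pose p : C := (t == 1%g)%:R; pose q : C := (t == s^-1)%g%:R.
  have ca (k : 'I_4) : 'i%C ^+ k * coef (a k) t =
      4^-1 * (2 * p * 'i%C ^+ k + q * ('i%C * 'i%C) ^+ k + r * (- ('i%C * 'i%C)) ^+ k).
    rewrite coefZ !coefD !coefZ coef_id !coef_lambda -/p -/q -/r -mulrN !exprMn.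
    ring.
  under eq_bigr do rewrite ca.
  rewrite -mulr_sumr !big_ord_recl big_ord0 /= /bump /= -expr2 sqr_i opprK !expr1n.
  rewrite !addr0 !expr0 !expr1 !exprS !expr0.
  have i2 : 'i%C * 'i%C = -1 :> C by rewrite -expr2 sqr_i.
  rewrite !mulr1 !i2.
  by field.
exists a; split=> //.
  by move=> k; split=> //=; rewrite VN_traceE ltry.
rewrite eq_sym -coef_lambda asum coef_sumE; apply: eq_bigr => k _.
rewrite [ttrace _]VN_traceE /= coef1_real//.
by have [] := apos k.
Qed.

(* See fourier_mul_lambda and fourier_mul_uniq. *)
Definition fourier_mul (u : G -> C) (x : op VN_alg) : op VN_alg :=
  \sum_t (u t * coef x t) *: lambda t.

Lemma fourier_mul_in (u : G -> C) x : VN x -> VN (fourier_mul u x).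
Proof. by move=> _; apply: VN_sum => t; exact: VN_lambda. Qed.

Lemma fourier_mul_linear (u : G -> C) : linear (fourier_mul u).
Proof.
move=> a x y; rewrite /fourier_mul scaler_sumr -big_split/=.
apply: eq_bigr => t _; rewrite scalerA -scalerDl coefD coefZ.
by rewrite mulrDr mulrCA.
Qed.

Lemma fourier_mul_lambda (u : G -> C) t :
  fourier_mul u (lambda t) = u t *: lambda t.
Proof.
rewrite /fourier_mul (bigD1 t)//= big1 ?addr0 => [|s st].
  by rewrite coef_lambda eqxx mulr1.
by rewrite coef_lambda (negbTE st) mulr0 scale0r.
Qed.

Lemma fourier_mul_uniq (u : G -> C) (T : op VN_alg -> op VN_alg) :
  (forall (a : C) x y, VN x -> VN y -> T (a *: x + y) = a *: T x + T y) ->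
  (forall t, T (lambda t) = u t *: lambda t) ->
  forall x, VN x -> T x = fourier_mul u x.
Proof.
move=> Tl Tu x Vx; rewrite [in LHS](VNE Vx).
have V0 : VN 0 by rewrite -(scale0r (idfun : H -> H)); exact/VNZ/VN_id.
have T0 : T 0 = 0.
  by have := Tl (-1) _ _ V0 V0; rewrite scaler0 addr0 scaleN1r addNr.
have Tsum (r : seq G) : VN (\sum_(t <- r) coef x t *: lambda t) /\
    T (\sum_(t <- r) coef x t *: lambda t) =
    \sum_(t <- r) coef x t *: T (lambda t).
  elim: r => [|t r [Vr Tr]]; rewrite ?big_nil ?big_cons; first by split.
  split; first by apply: VND => //; exact/VNZ/VN_lambda.
  by rewrite Tl ?Tr//; exact: VN_lambda.
rewrite (Tsum _).2; apply: eq_bigr => t _.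
by rewrite Tu scalerA mulrC.
Qed.

End GroupVNATheory.

(* Main.v *)
Require Import Defs.
From mathcomp Require Import all_boot all_order all_algebra all_fingroup.
From mathcomp Require Import ring sesquilinear complex.
From mathcomp Require Import all_classical all_reals ereal topology normedtype.

(* Let f_t, t in S_3, be the orbit of a vector of the 2-dimensional reflection
   representation, and u (s^-1 t) = <f_t, f_s>.  A dilation of M_u would give
   unitaries d_t in a finite von Neumann algebra, with d_1 = 1, such that
   tau (d_s^* d_t) = <f_t, f_s>.  The trace being faithful, the d_t satisfy the
   same linear relations as the f_t.  Writing z = d_r for a 3-cycle r, two more
   of the d_t are combinations of 1 and z, and their unitarity gives two linear
   equations in z and z^*.  For a suitable choice of the vector these equations
   are independent and force z to be a scalar of modulus less than 1, which
   contradicts the unitarity of z. *)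

Set Implicit Arguments.
Unset Strict Implicit.
Unset Printing Implicit Defensive.

Import Order.TTheory GRing.Theory Num.Theory.
Import numFieldNormedType.Exports.

Local Open Scope classical_set_scope.
Local Open Scope ring_scope.
Local Open Scope complex_scope.

(** * Sesquilinear forms and adjoints on a Hilbert space *)

Section Hilbert.
Context (R : realType) (H : hilbertSpace R).
Local Notation C := R[i].
Implicit Types (x y : H -> H) (u v : H).

Lemma hdotDl u v w : hdot H (u + v) w = hdot H u w + hdot H v w.
Proof. exact: (linearDl (hdot H)). Qed.

Lemma hdotDr u v w : hdot H w (u + v) = hdot H w u + hdot H w v.
Proof. exact: (linearDr (hdot H)). Qed.

Lemma hdotNl u v : hdot H (- u) v = - hdot H u v.
Proof. exact: (linearNl (hdot H)). Qed.

Lemma hdotNr u v : hdot H u (- v) = - hdot H u v.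
Proof. exact: (linearNr (hdot H)). Qed.

Lemma hdotZl (a : C) u v : hdot H (a *: u) v = a * hdot H u v.
Proof. exact: (linearZl_LR (hdot H)). Qed.

Lemma hdotZr (a : C) u v : hdot H u (a *: v) = a^*%R * hdot H u v.
Proof. exact: (linearZr_LR (hdot H)). Qed.

Lemma hdot_conj u v : hdot H v u = (hdot H u v)^*%R.
Proof. by rewrite (hermC (hdot H)) expr0 mul1r. Qed.

Lemma hdot_ge0 u : 0 <= hdot H u u.
Proof. exact: (@dnorm_ge0 _ _ (hdot H)). Qed.

Lemma hdot_eq0 u : hdot H u u = 0 -> u = 0.
Proof. by move/eqP; rewrite (@dnorm_eq0 _ _ (hdot H) u) => /eqP. Qed.

Lemma imagC_sqr : 'i%C * 'i%C = -1 :> C.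
Proof. by rewrite -expr2 sqr_i. Qed.

Lemma imagC_conj : ('i%C : C)^*%R = - 'i%C.
Proof. by rewrite complexiE conjCi. Qed.

Lemma is_adjoint_sym x y : is_adjoint x y -> is_adjoint y x.
Proof. by move=> xy u v; rewrite hdot_conj -xy -hdot_conj. Qed.

Lemma is_adjointD x y x' y' : is_adjoint x x' -> is_adjoint y y' ->
  is_adjoint (x + y) (x' + y').
Proof. by move=> xx' yy' u v; rewrite hdotDl xx' yy' -hdotDr. Qed.

Lemma is_adjointZ (a : C) x x' : is_adjoint x x' ->
  is_adjoint (a *: x) (a^*%R *: x').
Proof. by move=> xx' u v; rewrite hdotZl xx' [RHS]hdotZr conjCK. Qed.

Lemma is_adjoint_comp x y x' y' : is_adjoint x x' -> is_adjoint y y' ->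
  is_adjoint (x \o y) (y' \o x').
Proof. by move=> xx' yy' u v /=; rewrite xx' yy'. Qed.

(** Complex polarization: testing at [u + v] and [u + 'i *: v], where [v = x u - y u], isolates the
    square norm of [v]. *)
Lemma quad_form_inj x y : linear x -> linear y ->
  (forall u, hdot H (x u) u = hdot H (y u) u) -> x = y.
Proof.
move=> xl yl xy; apply/funext => u; apply/eqP; rewrite -subr_eq0; apply/eqP.
apply: hdot_eq0; set v := x u - y u.
have polar w : hdot H (x u - y u) w + hdot H (x w - y w) u = 0.
  have := xy (u + w); rewrite (linD u w xl) (linD u w yl) !hdotDl !hdotDr !xy => /eqP.
  rewrite -subr_eq0 => /eqP e. rewrite !hdotNl.
  by rewrite -[RHS]e; ring.
have p1 := polar v; have := polar ('i *: v).
rewrite (linZ 'i v xl) (linZ 'i v yl) -scalerBr hdotZr hdotZl imagC_conj mulNr addrC -mulrBr => /eqP.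
rewrite mulf_eq0 => /orP[|/eqP p2].
  by move=> /eqP i0; have := imagC_sqr; rewrite i0 mul0r => /eqP; rewrite eq_sym oppr_eq0 oner_eq0.
move: p1 p2; rewrite -/v => p1 p2.
have := congr2 (fun a b => a - b) p1 p2; rewrite subr0 opprB addrACA subrr addr0.
by move=> /eqP; rewrite -mulr2n mulrn_eq0 => /orP[//|/eqP].
Qed.

(** Positive operators have real quadratic forms, so those of [x] and [y] are the real and imaginary
    parts of the form of [x + 'i%C *: y]. *)
Lemma positive_quad_inj x y x' y' : linear x -> linear y -> linear x' -> linear y' ->
  positive_op x -> positive_op y -> positive_op x' -> positive_op y' ->
  x + 'i%C *: y = x' + 'i%C *: y' -> x = x' /\ y = y'.
Proof.
move=> xl yl x'l y'l x0 y0 x'0 y'0 e.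
have q u : hdot H (x u) u = hdot H (x' u) u /\ hdot H (y u) u = hdot H (y' u) u.
  have := congr1 (fun f : H -> H => hdot H (f u) u) e.
  rewrite !hdotDl !hdotZl.
  have := x0 u; have := y0 u; have := x'0 u; have := y'0 u.
  do 4!(move=> /ger0_real/RRe_real <-).
  by move=> /eqP; rewrite eq_complex /= !(mul0r, mul1r, addr0, subr0, add0r) => /andP[/eqP -> /eqP ->].
by split; apply: quad_form_inj => // u; have [] := q u.
Qed.

End Hilbert.

(** * Algebraic closure properties of von Neumann algebras *)

Section VonNeumann.
Context (R : realType) (H : hilbertSpace R).
Local Notation C := R[i].
Implicit Types (x y : H -> H) (S M : set (H -> H)).

(** The bound in [bounded_op] is any complex number, and on the zero space nothing constrains it;
    its modulus always serves. *)
Lemma bounded_op_nneg x : bounded_op x ->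
  exists2 K : C, 0 <= K & forall u, `|x u| <= K * `|u|.
Proof.
move=> [_ [K xK]]; exists `|K| => // u.
have K0 : 0 <= K * `|u| by apply: le_trans (xK u).
by rewrite -[`|u| in leRHS]normr_id -normrM ger0_norm.
Qed.

Lemma bounded_opD x y : bounded_op x -> bounded_op y -> bounded_op (x + y).
Proof.
move=> [xl [K xK]] [yl [K' yK]]; split.
  move=> a u v; rewrite /= !fctE (xl a u v) (yl a u v) scalerDr.
  by rewrite addrACA.
exists (K + K') => u; rewrite mulrDl.
by apply: le_trans (ler_normD _ _) _; exact: lerD.
Qed.

Lemma bounded_opZ (a : C) x : bounded_op x -> bounded_op (a *: x).
Proof.
move=> [xl [K xK]]; split.
  by move=> b u v; rewrite /= !fctE (xl b u v) scalerDr !scalerA mulrC.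
by exists (`|a| * K) => u; rewrite normrZ -mulrA ler_wpM2l.
Qed.

Lemma bounded_op_comp x y : bounded_op x -> bounded_op y -> bounded_op (x \o y).
Proof.
move=> xb [yl [K' yK]]; have [K K0 xK] := bounded_op_nneg xb; have [xl _] := xb.
split; first by move=> a u v; rewrite /= (yl a u v) (xl a (y u) (y v)).
exists (K * K') => u; apply: le_trans (xK _) _.
by rewrite -mulrA ler_wpM2l.
Qed.

Lemma bounded_op_id : bounded_op (idfun : H -> H).
Proof. by split=> //; exists 1 => u; rewrite mul1r. Qed.

Lemma commutant_bounded S x : commutant S x -> bounded_op x.
Proof. by case. Qed.

Lemma commutantD S x y : (forall z, S z -> bounded_op z) ->
  commutant S x -> commutant S y -> commutant S (x + y).
Proof.
move=> Sb [xb xC] [yb yC]; split; first exact: bounded_opD.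
move=> z Sz; apply/funext => u; have [zl _] := Sb _ Sz.
rewrite /= !fctE (linD _ _ zl); congr (_ + _).
  exact: (congr1 (fun f => f u) (xC _ Sz)).
exact: (congr1 (fun f => f u) (yC _ Sz)).
Qed.

Lemma commutantZ S (a : C) x : (forall z, S z -> bounded_op z) ->
  commutant S x -> commutant S (a *: x).
Proof.
move=> Sb [xb xC]; split; first exact: bounded_opZ.
move=> z Sz; apply/funext => u; have [zl _] := Sb _ Sz.
rewrite /= !fctE (linZ _ _ zl); congr (_ *: _).
exact: (congr1 (fun f => f u) (xC _ Sz)).
Qed.

Lemma commutant_comp S x y : commutant S x -> commutant S y -> commutant S (x \o y).
Proof.
move=> [xb xC] [yb yC]; split; first exact: bounded_op_comp.
move=> z Sz; rewrite -[RHS]/(x \o (y \o z)) -(yC _ Sz).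
exact: (congr1 (fun f => f \o y) (xC _ Sz)).
Qed.

Lemma commutant_id S : commutant S idfun.
Proof. by split=> //; exact: bounded_op_id. Qed.

Context (M : set (H -> H)) (Mv : is_vonNeumann M).

(** [M] is the commutant of [commutant M], so this and the closure properties below are inherited
    from commutants. *)
Lemma vN_bounded x : M x -> bounded_op x.
Proof. by rewrite -(vN_bicommutant Mv); exact: commutant_bounded. Qed.

Lemma vN_linear x : M x -> linear x.
Proof. by move=> /vN_bounded[]. Qed.

Lemma vND x y : M x -> M y -> M (x + y).
Proof.
by rewrite -(vN_bicommutant Mv); apply: commutantD => z; exact: commutant_bounded.
Qed.

Lemma vNZ (a : C) x : M x -> M (a *: x).
Proof.
by rewrite -(vN_bicommutant Mv); apply: commutantZ => z; exact: commutant_bounded.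
Qed.

Lemma vN_comp x y : M x -> M y -> M (x \o y).
Proof. by rewrite -(vN_bicommutant Mv); exact: commutant_comp. Qed.

Lemma vN_id : M idfun.
Proof. by rewrite -(vN_bicommutant Mv); exact: commutant_id. Qed.

Lemma vN0 : M 0.
Proof. by rewrite -(scale0r (idfun : H -> H)); exact/vNZ/vN_id. Qed.

Lemma vN_sum (I : finType) (a : I -> C) (f : I -> H -> H) :
  (forall i, M (f i)) -> M (\sum_i a i *: f i).
Proof.
move=> Mf; elim/big_ind : _ => [|x y|i _]; [exact: vN0|exact: vND|exact: vNZ].
Qed.

End VonNeumann.

(** * The linear extension of the trace to its definition ideal *)

Section Trace.
Context (R : realType) (M : tracialVNA R).
Local Notation C := R[i].
Implicit Types (x y : op M) (a b c d : C).

Let Mv : is_vonNeumann (tcarrier M) := tcarrierP M.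
Let Mt : is_nsf_trace (tcarrier M) (@ttrace R M) := ttraceP M.

Lemma positive_part0 : positive_part M 0.
Proof.
split=> [|u]; first exact: vN0.
by rewrite (linear0l (hdot (tspace M))).
Qed.

Lemma positive_partD x y : positive_part M x -> positive_part M y ->
  positive_part M (x + y).
Proof.
move=> [Mx x0] [My y0]; split=> [|u]; first exact: vND.
by rewrite hdotDl addr_ge0.
Qed.

Lemma positive_partZ (r : R) x : 0 <= r -> positive_part M x ->
  positive_part M (r%:C *: x).
Proof.
move=> r0 [Mx x0]; split=> [|u]; first exact: vNZ.
by rewrite hdotZl mulr_ge0// lecR.
Qed.

Lemma positive_part_adj x y : tcarrier M x -> tcarrier M y -> is_adjoint x y ->
  positive_part M (y \o x).
Proof.
move=> Mx My xy; split=> [|u]; first exact: vN_comp.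
by rewrite /= (is_adjoint_sym xy) hdot_ge0.
Qed.

Lemma ttrace0 : ttrace (0 : op M) = 0%E.
Proof.
by have := traceZ Mt (lexx 0) positive_part0; rewrite scaler0 mul0e.
Qed.

Definition fin_positive x := positive_part M x /\ (ttrace x < +oo)%E.

Lemma fin_positive_num x : fin_positive x -> ttrace x \is a fin_num.
Proof. by move=> [x0 xoo]; rewrite ge0_fin_numE//; exact: (trace_ge0 Mt). Qed.

Lemma fin_positiveD x y : fin_positive x -> fin_positive y -> fin_positive (x + y).
Proof.
move=> [x0 xoo] [y0 yoo]; split; first exact: positive_partD.
by rewrite (traceD Mt x0 y0) lte_add_pinfty.
Qed.

Lemma fin_positiveZ (r : R) x : 0 <= r -> fin_positive x -> fin_positive (r%:C *: x).
Proof.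
move=> r0 fx; have [x0 xoo] := fx; split; first exact: positive_partZ.
by rewrite (traceZ Mt r0 x0) -(fineK (fin_positive_num fx)) -EFinM ltry.
Qed.

Lemma fin_positive0 : fin_positive 0.
Proof. by split; [exact: positive_part0|rewrite ttrace0 ltry]. Qed.

Lemma fin_positive_le x y : positive_part M x -> fin_positive y -> le_op x y ->
  fin_positive x.
Proof.
move=> x0 [[My y0] yoo] xy; split=> //.
have yx0 : positive_part M (y - x).
  split=> //; rewrite -scaleN1r; apply: vND => //; apply: vNZ => //.
  by have [] := x0.
apply: le_lt_trans yoo; rewrite -(subrK x y) (traceD Mt)//.
by rewrite leeDr// (trace_ge0 Mt).
Qed.

Lemma has_trace_fin_positive x : fin_positive x ->
  has_trace x (fine (ttrace x))%:C.
Proof.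
move=> fx; exists (fun k : 'I_4 => if k == ord0 then x else 0); split.
- by move=> k; case: ifP => _ //; exact: fin_positive0.
- by rewrite big_ord_recl big1 ?addr0 ?scale1r//= => k _; rewrite scaler0.
- by rewrite big_ord_recl big1 ?addr0 ?mul1r//= => k _; rewrite ttrace0 mulr0.
Qed.

Lemma has_traceD x y c d : has_trace x c -> has_trace y d -> has_trace (x + y) (c + d).
Proof.
move=> [f [f0 -> ->]] [g [g0 -> ->]]; exists (fun k => f k + g k); split.
- by move=> k; exact: fin_positiveD.
- by rewrite -big_split/=; apply: eq_bigr => k _; rewrite scalerDr.
- rewrite -big_split/=; apply: eq_bigr => k _.
  by rewrite (traceD Mt (f0 k).1 (g0 k).1) fineD ?fin_positive_num// rmorphD mulrDr.
Qed.

Lemma has_trace0 : has_trace (0 : op M) 0.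
Proof. by have := has_trace_fin_positive fin_positive0; rewrite ttrace0. Qed.

Lemma has_trace_sum (I : finType) (x : I -> op M) (c : I -> C) :
  (forall i, has_trace (x i) (c i)) -> has_trace (\sum_i x i) (\sum_i c i).
Proof.
move=> xc; elim/big_ind2 : _ => //; first exact: has_trace0.
by move=> y a z b; exact: has_traceD.
Qed.

Lemma has_traceZ_nneg (r : R) x c : 0 <= r -> has_trace x c ->
  has_trace (r%:C *: x) (r%:C * c).
Proof.
move=> r0 [f [f0 -> ->]]; exists (fun k => r%:C *: f k); split.
- by move=> k; exact: fin_positiveZ.
- by rewrite scaler_sumr; apply: eq_bigr => k _; rewrite !scalerA mulrC.
- rewrite mulr_sumr; apply: eq_bigr => k _.
  by rewrite (traceZ Mt r0 (f0 k).1) fineM ?fin_positive_num// rmorphM mulrCA.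
Qed.

Lemma imagC_exp4 : 'i%C ^+ 4 = 1 :> C.
Proof. by rewrite (exprM _ 2 2) sqr_i sqrrN expr1n. Qed.

(** Multiplication by ['i] permutes the four positive components cyclically. *)
Lemma has_traceZ_imag x c : has_trace x c -> has_trace ('i%C *: x) ('i%C * c).
Proof.
move=> [f [f0 -> ->]]; exists (fun k => f (ord_pred k)); split.
- by move=> k; exact: f0.
- rewrite scaler_sumr [RHS](reindex_inj (@ordS_inj 4))/=; apply: eq_bigr => k _.
  by rewrite ordSK (expr_mod _ imagC_exp4) scalerA -exprS.
- rewrite mulr_sumr [RHS](reindex_inj (@ordS_inj 4))/=; apply: eq_bigr => k _.
  by rewrite ordSK (expr_mod _ imagC_exp4) mulrA -exprS.
Qed.

(** The scalar is split as a sum of ['i ^+ k * r k], where the [r k >= 0] are the positive and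
    negative parts of its real and imaginary parts. *)
Lemma has_traceZ a x c : has_trace x c -> has_trace (a *: x) (a * c).
Proof.
move=> xc; pose r (k : 'I_4) : R := nth 0 [:: Num.max (complex.Re a) 0;
  Num.max (complex.Im a) 0; Num.max (- complex.Re a) 0; Num.max (- complex.Im a) 0] k.
have maxB (t : R) : Num.max t 0 - Num.max (- t) 0 = t.
  case: (leP 0 t) => t0.
    by rewrite max_r ?oppr_le0// subr0.
  by rewrite max_l ?oppr_ge0 ?ltW// sub0r opprK.
have aE : a = \sum_(k < 4) 'i%C ^+ k * (r k)%:C.
  rewrite !big_ord_recl big_ord0 /r/= /bump /=.
  rewrite expr0 expr1 (exprS _ 2) sqr_i.
  apply/eqP; rewrite eq_complex /=.
  rewrite !(mul0r, mulr0, mul1r, addr0, add0r, subr0, mulN1r, mulrN1, oppr0, mulNr, mulrN, mulr1, opprK)/=.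
  by rewrite !maxB !eqxx.
have imagX y d n : has_trace y d -> has_trace ('i%C ^+ n *: y) ('i%C ^+ n * d).
  move=> yd; elim: n => [|n IH]; first by rewrite scale1r mul1r.
  by rewrite exprS -scalerA -mulrA; exact: has_traceZ_imag.
have r0 k : 0 <= r k.
  by case: k => -[|[|[|[]]]]// lk; rewrite /r/= le_max lexx orbT.
rewrite aE scaler_suml mulr_suml; apply: has_trace_sum => k.
by rewrite -scalerA -mulrA; apply/imagX/has_traceZ_nneg.
Qed.

(** This makes the extended trace single-valued: if four positive components combine to 0, they
    cancel in opposite pairs, and so do their traces. *)
Lemma has_trace_eq0 c : has_trace (0 : op M) c -> c = 0.
Proof.
move=> [f [f0 e ->]].
have flin k : linear (f k) by apply: (vN_linear Mv); have [[]] := f0 k.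
have fpos k : positive_op (f k) by have [[]] := f0 k.
have i3 : 'i%C ^+ 3 = - 'i%C :> C by rewrite (exprS _ 2) sqr_i mulrN1.
have sum4 (V : nmodType) (F : 'I_4 -> V) :
    \sum_k F k = F 0 + F 1 + (F (1 + 1) + F (1 + 1 + 1)).
  rewrite !big_ord_recl big_ord0 addr0 !addrA.
  by congr (_ + F _ + F _ + F _); exact: val_inj.
(* Here [1 + 1] and [1 + 1 + 1] are the indices 2 and 3 of ['I_4]; the relation reads f_0 + i f_1 =
   f_2 + i f_3. *)
have [e02 e13] : f 0 = f (1 + 1) /\ f 1 = f (1 + 1 + 1).
  apply: positive_quad_inj => //; apply/eqP; rewrite -subr_eq0 [X in _ == X]e sum4/=.
  by rewrite expr1 sqr_i i3 expr0 !scale1r scaleN1r scaleNr opprD.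
by rewrite sum4 e02 e13 /= -complexiE expr1 sqr_i i3 expr0; ring.
Qed.

Lemma has_trace_uniq x c d : has_trace x c -> has_trace x d -> c = d.
Proof.
move=> xc /(has_traceZ (-1))/(has_traceD xc).
by rewrite scaleN1r mulN1r subrr => /has_trace_eq0/eqP; rewrite subr_eq0 => /eqP.
Qed.

Lemma has_trace_faithful x : fin_positive x -> has_trace x 0 -> x = 0.
Proof.
move=> fx xc; apply: (trace_faithful Mt fx.1).
have := has_trace_uniq (has_trace_fin_positive fx) xc => /eqP.
rewrite eq_complex/= eqxx andbT => /eqP e.
by rewrite -(fineK (fin_positive_num fx)) e.
Qed.

(** * Finite traces: cyclicity and Gram matrices *)

Section Finite.
Context (Mfin : (ttrace (idfun : op M) < +oo)%E).

(** If [K] bounds [x], then x^* x is dominated by K^2 times the identity, which has finite trace. *)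
Lemma fin_positive_adj x y : tcarrier M x -> tcarrier M y -> is_adjoint x y ->
  fin_positive (y \o x).
Proof.
move=> Mx My xy; have [K K0 xK] := bounded_op_nneg (vN_bounded Mv Mx).
have fid : fin_positive idfun.
  by split=> //; split; [exact: (vN_id Mv)|exact: hdot_ge0].
have KE : K = (complex.Re K)%:C by rewrite [RHS]RRe_real// ger0_real.
apply: (fin_positive_le (y := (complex.Re K ^+ 2)%:C *: idfun)).
- exact: positive_part_adj.
- by apply: fin_positiveZ => //; exact: sqr_ge0.
move=> u; rewrite hdotDl hdotNl hdotZl rmorphXn/= -KE (is_adjoint_sym xy).
by rewrite subr_ge0 -!hnormE -exprMn ler_pXn2r ?nnegrE ?mulr_ge0.
Qed.

Lemma imagXX n : 'i%C ^+ n * (- 'i%C) ^+ n = 1 :> C.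
Proof. by rewrite -exprMn mulrN imagC_sqr opprK expr1n. Qed.

(** Orthogonality of the powers of ['i]: the terms in [p], [r] and [s] carry i^k, (-1)^k and i^k,
    which sum to 0 over a period. *)
Lemma imag_sum (V : lmodType C) (p q r s : V) :
  \sum_(k < 4) 'i%C ^+ k *: (p + (- 'i%C) ^+ k *: q + ('i%C ^+ k *: r + s)) =
  4 *: q.
Proof.
under eq_bigr do rewrite !scalerDr !scalerA imagXX -exprMn imagC_sqr.
rewrite !big_split/= -!scaler_suml.
rewrite !big_ord_recl !big_ord0 /= /bump /= !expr0 !expr1 sqrrN expr1n.
rewrite !(exprS _ 2) sqr_i sqrrN expr1n.
have -> : 1 + ('i + (-1 + ('i * -1 + 0))) = 0 :> C by ring.
have -> : 1 + (-1 + (1 + (-1 * 1 + 0))) = 0 :> C by ring.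
by rewrite !scale0r !(addr0, add0r).
Qed.

(* The trace axiom only gives tau(x^* x) = tau(x x^* ).  Polarizing products
   xy = 1/4 sum_k i^k w_k w_k^*, w_k = x + i^k y^*, avoids the square roots that
   the reduction to positive elements would require. *)
Lemma has_trace_comm x y : tcarrier M x -> tcarrier M y ->
  exists2 c, has_trace (x \o y) c & has_trace (y \o x) c.
Proof.
move=> Mx My.
have [x' Mx' xx'] := vN_adjoint Mv Mx; have [y' My' yy'] := vN_adjoint Mv My.
pose w (k : 'I_4) : op M := x + 'i%C ^+ k *: y'.
pose w' (k : 'I_4) : op M := x' + (- 'i%C) ^+ k *: y.
have Mw k : tcarrier M (w k) by apply: (vND Mv) => //; exact: (vNZ Mv).
have Mw' k : tcarrier M (w' k) by apply: (vND Mv) => //; exact: (vNZ Mv).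
have ww' k : is_adjoint (w k) (w' k).
  apply: is_adjointD => //; rewrite -imagC_conj -rmorphXn.
  by apply: is_adjointZ; exact: is_adjoint_sym.
pose c k : C := (fine (ttrace (w' k \o w k)))%:C.
have tr1 k : has_trace (w' k \o w k) (c k).
  by apply: has_trace_fin_positive; exact: fin_positive_adj.
have tr2 k : has_trace (w k \o w' k) (c k).
  rewrite /c (trace_cyclic Mt (Mw k) (ww' k)); apply: has_trace_fin_positive.
  by apply: fin_positive_adj => //; exact: is_adjoint_sym.
have xyE : x \o y = 4^-1 *: \sum_(k < 4) 'i%C ^+ k *: (w k \o w' k).
  apply/funext => u; rewrite fctE /= fctE fct_sumE.
  rewrite -[LHS]scale1r -[1 in LHS](@mulVf _ 4) // -scalerA; congr (_ *: _).
  rewrite -(imag_sum (x (x' u)) (x (y u)) (y' (x' u)) (y' (y u))).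
  apply: eq_bigr => k _; rewrite fctE; congr (_ *: _).
  rewrite /= /w /w' !fctE (linD _ _ (vN_linear Mv Mx)) (linD _ _ (vN_linear Mv My')).
  rewrite (linZ _ _ (vN_linear Mv Mx)) (linZ _ _ (vN_linear Mv My')).
  by rewrite scalerDr scalerA imagXX scale1r.
have yxE : y \o x = 4^-1 *: \sum_(k < 4) 'i%C ^+ k *: (w' k \o w k).
  apply/funext => u; rewrite fctE /= fctE fct_sumE.
  rewrite -[LHS]scale1r -[1 in LHS](@mulVf _ 4) // -scalerA; congr (_ *: _).
  rewrite -(imag_sum (x' (x u)) (y (x u)) (x' (y' u)) (y (y' u))).
  apply: eq_bigr => k _; rewrite fctE; congr (_ *: _).
  rewrite /= /w /w' !fctE (linD _ _ (vN_linear Mv Mx')) (linD _ _ (vN_linear Mv My)).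
  rewrite (linZ _ _ (vN_linear Mv Mx')) (linZ _ _ (vN_linear Mv My)) addrACA.
  by rewrite scalerDr scalerA [_ * 'i%C ^+ _]mulrC imagXX scale1r.
exists (4^-1 * \sum_(k < 4) 'i%C ^+ k * c k).
  by rewrite xyE; apply/has_traceZ/has_trace_sum => k; exact: has_traceZ.
by rewrite yxE; apply/has_traceZ/has_trace_sum => k; exact: has_traceZ.
Qed.

(* If the Gram matrix of the [d i] for the trace is that of the vectors [f i],
   then faithfulness transfers linear relations from the [f i] to the [d i]. *)
Lemma gram_relation (I J : finType) (d d' : I -> op M) (f : I -> J -> C) (c : I -> C) :
  (forall i, tcarrier M (d i)) -> (forall i, tcarrier M (d' i)) ->
  (forall i, is_adjoint (d i) (d' i)) ->
  (forall i j, has_trace (d' i \o d j) (\sum_k f j k * (f i k)^*%R)) ->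
  (forall k, \sum_i c i * f i k = 0) -> \sum_i c i *: d i = 0.
Proof.
move=> Md Md' dd' tr_d cf.
set D := \sum_i _; pose D' := \sum_i (c i)^*%R *: d' i.
have MD : tcarrier M D by exact: vN_sum.
have MD' : tcarrier M D' by exact: vN_sum.
have DD' : is_adjoint D D'.
  rewrite /D /D'; elim/big_ind2 : _ => [u v|x1 x2 y1 y2|i _].
  - by rewrite (linear0l (hdot (tspace M))) (linear0r (hdot (tspace M))).
  - exact: is_adjointD.
  - exact: is_adjointZ.
(* The trace of D^* D is the square norm of sum_i c_i f_i, which vanishes by [cf]. *)
suff D'D0 : D' \o D = 0.
  apply/funext => u; apply: hdot_eq0; rewrite DD'.
  by rewrite -[D' (D u)]/((D' \o D) u) D'D0 (linear0r (hdot (tspace M))).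
apply: has_trace_faithful; first exact: fin_positive_adj.
have -> : D' \o D = \sum_i \sum_j ((c i)^*%R * c j) *: (d' i \o d j).
  apply/funext => u; rewrite /= {1}/D' !fct_sumE; apply: eq_bigr => i _.
  rewrite fctE /D fct_sumE (lin_sum _ _ (vN_linear Mv (Md' i))) scaler_sumr fct_sumE.
  by apply: eq_bigr => j _; rewrite scalerA.
have -> : 0 = \sum_i \sum_j (c i)^*%R * c j * \sum_k f j k * (f i k)^*%R.
  transitivity (\sum_k (\sum_j c j * f j k) * (\sum_i c i * f i k)^*%R).
    by rewrite big1// => k _; rewrite cf mul0r.
  under [LHS]eq_bigr => k _ do rewrite rmorph_sum mulr_sumr.
  rewrite exchange_big/=; apply: eq_bigr => i _.
  under [LHS]eq_bigr => k _ do rewrite mulr_suml.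
  rewrite exchange_big/=; apply: eq_bigr => j _.
  rewrite mulr_sumr; apply: eq_bigr => k _; rewrite rmorphM; ring.
by do 2!apply: has_trace_sum => ?; exact: has_traceZ.
Qed.

End Finite.
End Trace.

(** * Complete positivity and dilations of Fourier multipliers *)

Section FourierMultiplier.
Context (R : realType) (G : finGroupType).
Local Notation C := R[i].
Local Notation H := (ell2_hilbert R G).
Local Notation L := (ell2 R G).
Local Notation VN := (VN_alg R G).
Local Notation dot := (@ell2_dot R G : {dot L for @Num.conj C}).

Lemma lambdaM (s t : G) : (lambda s : H -> H) \o lambda t = lambda (s * t)%g.
Proof. by apply/funext => xi; apply/ffunP => r; rewrite !ffunE invMg mulgA. Qed.

Lemma lambda_adjoint (t : G) : is_adjoint (lambda t : H -> H) (lambda t^-1%g).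
Proof.
move=> xi eta; rewrite !hdotE /ell2_dot (reindex_inj (mulgI t))/=.
by apply: eq_bigr => s _; rewrite !ffunE mulKg invgK.
Qed.

Lemma dot_sum (c : G -> C) (xi eta : H) :
  hdot H ((\sum_t c t *: (lambda t : H -> H)) xi) eta =
  \sum_t c t * ell2_dot (lambda t xi : L) (eta : L).
Proof.
rewrite sum_opE hdotE (linear_sumlz dot)/=; apply: eq_bigr => t _.
by rewrite (linearZl_LR dot).
Qed.

(* The Kraus operators of the multiplier are the multiplications by the
   [g k] on l^2(G). *)
Lemma fourier_mul_cp (J : finType) (g : J -> G -> C) (u : G -> C) :
  (forall s t, u t = \sum_k g k s * (g k (t * s)%g)^*%R) ->
  completely_positive VN (fourier_mul u).
Proof.
move=> ug; pose V k (xi : H) : H := [ffun s => g k s * (xi : L) s].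
(* Weak form of T x = sum_k V_k^* x V_k; positivity of the amplified map then follows by testing [x]
   on the vectors [V k (xi i)]. *)
have kraus x (xi eta : H) : tcarrier VN x ->
    hdot H (fourier_mul u x xi) eta = \sum_k hdot H (x (V k xi)) (V k eta).
  move=> Vx; rewrite dot_sum.
  transitivity (\sum_k \sum_t coef x t * ell2_dot (lambda t (V k xi) : L) (V k eta : L));
    last by apply: eq_bigr => k _; rewrite -dot_sum -(VNE Vx).
  rewrite exchange_big/=; apply: eq_bigr => t _.
  rewrite -mulr_sumr [u t * _]mulrC -mulrA; congr (_ * _).
  rewrite /ell2_dot mulr_sumr exchange_big/=; apply: eq_bigr => s _.
  rewrite (ug (t^-1 * s)%g t) mulr_suml; apply: eq_bigr => k _.
  by rewrite !ffunE mulKVg rmorphM/=; ring.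
move=> n x Vx x0 xi.
have -> : \sum_i \sum_j hdot H (map_mx (fourier_mul u) x i j (xi j)) (xi i) =
    \sum_k \sum_i \sum_j hdot H (x i j (V k (xi j))) (V k (xi i)).
  rewrite [RHS]exchange_big/=; apply: eq_bigr => i _.
  rewrite [RHS]exchange_big/=; apply: eq_bigr => j _.
  by rewrite mxE kraus.
by apply: sumr_ge0 => k _; exact: (x0 (fun i => V k (xi i))).
Qed.

Lemma fourier_mul_unital (u : G -> C) : u 1%g = 1 -> unital (fourier_mul u).
Proof. by move=> u1; rewrite /unital -[idfun]lambda1 fourier_mul_lambda u1 scale1r. Qed.

(* With a = J lambda and b = U a, the unitaries are d t = b_t a_t^-1; then
   (d s)^* (d t) = a_s b_(s^-1 t) a_t^-1, which has the trace of
   b_(s^-1 t) a_(s^-1 t)^-1. *)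
Lemma dilation_unitaries (u : G -> C) : admits_absolute_dilation (fourier_mul u) ->
  exists (M : tracialVNA R) (d d' : G -> op M),
  [/\ ttrace (idfun : op M) = 1%E,
      d 1%g = idfun /\ (forall t, d' t \o d t = idfun),
      forall t, [/\ tcarrier M (d t), tcarrier M (d' t) & is_adjoint (d t) (d' t)] &
      forall s t, has_trace (d' s \o d t) (u (s^-1 * t)%g)].
Proof.
move=> [M [J [U [E [[SJ _ J1 Jtr] [SU [_ _ Usurj] _] [EM Eadj] dil]]]]].
have Mv := tcarrierP M.
pose a (t : G) : op M := J (lambda t); pose b t : op M := U (a t).
have VNl t : tcarrier VN (lambda t) by exact: VN_lambda.
have Ma t : tcarrier M (a t) by apply: (star_hom_in SJ); exact: VNl.
have Mb t : tcarrier M (b t) by apply: (star_hom_in SU).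
have aM s t : a s \o a t = a (s * t)%g.
  by rewrite /a -(star_homM SJ)// -lambdaM.
have bM s t : b s \o b t = b (s * t)%g.
  by rewrite /b -(star_homM SU)// aM.
have a1 : a 1%g = idfun by rewrite /a lambda1.
(* Unitality is not a field of [star_hom]; for [U] it follows from multiplicativity and a preimage
   of the identity. *)
have b1 : b 1%g = idfun.
  have [x Mx Ux] := Usurj _ (vN_id Mv).
  rewrite /b a1 -[RHS]Ux -[x in RHS]/(idfun \o x) (star_homM SU) ?Ux//.
  exact: vN_id.
have aadj t : is_adjoint (a t) (a t^-1%g).
  by apply: (star_hom_adj SJ) => //; exact: lambda_adjoint.
have badj t : is_adjoint (b t) (b t^-1%g) by apply: (star_hom_adj SU).
have tr1 : ttrace (idfun : op M) = 1%E.
  rewrite -J1 Jtr; first by rewrite /= VN_traceE coef_id eqxx.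
  by split; [exact: VN_id|exact: hdot_ge0].
have Mfin : (ttrace (idfun : op M) < +oo)%E by rewrite tr1 ltry.
(* The dilation identity at k = 1, with the conditional expectation tested against [lambda t^-1]. *)
have tru t : has_trace (b t \o a t^-1%g) (u t).
  have [c] := Eadj _ _ _ (Mb t) (has_trace_lambda R t^-1%g).
  have <- : fourier_mul u (lambda t) = E (b t) by exact: (dil 1%N).
  rewrite fourier_mul_lambda.
  have -> : (u t *: (lambda t : H -> H)) \o lambda t^-1%g = u t *: lambda 1%g.
    by rewrite -[1%g](mulgV t) -lambdaM.
  have := has_traceZ (u t) (has_trace_lambda R (1%g : G)).
  by rewrite eqxx mulr1 => /has_trace_uniq h /h <-.
exists M, (fun t => b t \o a t^-1%g), (fun t => a t \o b t^-1%g); split => //.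
- split=> [|t]; first by rewrite invg1 a1 b1.
  rewrite -[LHS]/(a t \o (b t^-1%g \o b t) \o a t^-1%g) bM mulVg b1.
  by rewrite -[LHS]/(a t \o a t^-1%g) aM mulgV.
- move=> t; split; [exact: vN_comp|exact: vN_comp|].
  exact: is_adjoint_comp (badj t) (is_adjoint_sym (aadj t)).
move=> s t; set g := (s^-1 * t)%g.
rewrite -[_ \o _]/((a s \o (b s^-1%g \o b t)) \o a t^-1%g) bM -/g.
(* Cyclicity is applied twice: first a_t^-1 moves to the front, giving a_g^-1 b_g, then the two
   factors are swapped to meet [tru]. *)
have [c sc] := has_trace_comm Mfin (vN_comp Mv (Ma s) (Mb g)) (Ma t^-1%g).
rewrite -[_ \o _]/((a t^-1%g \o a s) \o b g) aM.
have -> : (t^-1 * s = g^-1)%g by rewrite /g invMg invgK.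
have [c' /(has_trace_uniq (tru g)) -> h /(has_trace_uniq h) ->] :=
  has_trace_comm Mfin (Mb g) (Ma g^-1%g).
exact: sc.
Qed.

End FourierMultiplier.

(** * The counterexample on the symmetric group *)

Section SymmetricGroup.
Context (R : realType).
Local Notation C := R[i].

(* The coordinates sum to 0, so this lies in the reflection representation.  For
   a multiple of a real vector the two linear equations in z and z^* would be
   dependent. *)
Definition vec3 (k : 'I_3) : C := nth 0 [:: 1; 'i%C; -1 - 'i%C] k.

(** The diagonal coefficient of the permutation representation at [vec3], normalized by the square
    norm 1 + 1 + 2 = 4. *)
Definition symbol3 (t : 'S_3) : C := 4^-1 * \sum_k vec3 (t k) * (vec3 k)^*%R.

Definition cycle3 : 'S_3 := (tperm 0%R 1%R * tperm 0%R 2%R)%g.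
Definition swap3 : 'S_3 := tperm 0 1.

Lemma half_conj (a b : C) : 4^-1 * (a * b^*%R) = (2^-1 * a) * (2^-1 * b)^*%R.
Proof.
have h : (2^-1 : C)^*%R = 2^-1 by rewrite fmorphV rmorph_nat.
by rewrite rmorphM/= h; field.
Qed.

(** The Gram identity of the orbit at (t s)^-1 and s^-1; the inverses adapt it to [fourier_mul_cp],
    which compares [s] with [t * s]. *)
Lemma symbol3_kraus (s t : 'S_3) :
  symbol3 t = \sum_k (2^-1 * vec3 (s^-1%g k)) * (2^-1 * vec3 ((t * s)^-1%g k))^*%R.
Proof.
rewrite /symbol3 mulr_sumr [RHS](reindex_inj (@perm_inj _ (t * s)%g))/=.
by apply: eq_bigr => k _; rewrite half_conj permK permM permK.
Qed.

(** Substitute [s k] for [k]: permutations compose from left to right, so s^-1 t sends [s k] to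
    [t k]. *)
Lemma symbol3_gram (s t : 'S_3) :
  symbol3 (s^-1 * t)%g = \sum_k (2^-1 * vec3 (t k)) * (2^-1 * vec3 (s k))^*%R.
Proof.
rewrite /symbol3 mulr_sumr (reindex_inj (@perm_inj _ s))/=.
by apply: eq_bigr => k _; rewrite half_conj permM permK.
Qed.

Lemma symbol3_1 : symbol3 1%g = 1.
Proof.
rewrite /symbol3 !big_ord_recl big_ord0 !perm1 /vec3 /= addr0.
rewrite rmorphB rmorphN1/= rmorph1 !imagC_conj.
have -> : 1 * 1 + ('i%C * - 'i%C + (-1 - 'i%C) * (-1 - - 'i%C)) =
  2 - 2 * ('i%C * 'i%C) :> C by ring.
by rewrite imagC_sqr; field.
Qed.

(** The orbit of [k] under the 3-cycle meets every coordinate once, and the coordinates of [vec3]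
    sum to 0. *)
Lemma vec3_cycle (k : 'I_3) :
  vec3 k + vec3 (cycle3 k) + vec3 ((cycle3 * cycle3)%g k) = 0.
Proof.
case: k => -[|[|[|//]]] lk; rewrite !permM !permE /= /vec3 /=; ring.
Qed.

(** [vec3] and its rotate form a basis of the reflection representation; the coefficients are the
    coordinates of the swapped vector in it. *)
Lemma vec3_swap (k : 'I_3) :
  (2 + 'i%C) * vec3 k + 2 * 'i%C * vec3 (cycle3 k) - vec3 (swap3 k) = 0.
Proof.
(* [ring] treats ['i] as an indeterminate, so each coordinate is exhibited as a multiple of i^2 +
   1. *)
have ii (a b : C) : b = a * ('i%C * 'i%C + 1) -> b = 0.
  by rewrite imagC_sqr addNr mulr0.
case: k => -[|[|[|//]]] lk; rewrite ?permM !permE /= /vec3 /=.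
- by apply: (ii 2); ring.
- by apply: (ii (-1)); ring.
- by apply: (ii (-1)); ring.
Qed.

Lemma symbol3_not_dilatable : ~ admits_absolute_dilation (fourier_mul symbol3).
Proof.
move=> /dilation_unitaries[M [d [d' [tr1 [d1 dK] dM dtr]]]].
have Mfin : (ttrace (idfun : op M) < +oo)%E by rewrite tr1 ltry.
pose f (t : 'S_3) k : C := 2^-1 * vec3 (t k).
have rel (t1 t2 t3 : 'S_3) (a b c : C) u :
    (forall k, a * vec3 (t1 k) + b * vec3 (t2 k) + c * vec3 (t3 k) = 0) ->
    a *: d t1 u + b *: d t2 u + c *: d t3 u = 0.
  move=> rel_f; pose t (i : 'I_3) := nth 1%g [:: t1; t2; t3] i.
  have := @gram_relation _ _ Mfin 'I_3 'I_3 (d \o t) (d' \o t) (f \o t)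
    (fun i => nth 0 [:: a; b; c] i).
  rewrite !big_ord_recl big_ord0 /= addr0 addrA => h.
  have <- : (a *: d t1 + b *: d t2 + c *: d t3) u =
      a *: d t1 u + b *: d t2 u + c *: d t3 u by [].
  rewrite h// => [i|i|i|i j|k].
  - by have [] := dM (t i).
  - by have [] := dM (t i).
  - by have [] := dM (t i).
  - by rewrite -symbol3_gram; exact: dtr.
  - rewrite !big_ord_recl big_ord0 /= addr0 addrA /f /t /=.
    by rewrite !(mulrCA _ 2^-1) -!mulrDr rel_f mulr0.
have iso t (u : tspace M) : hdot _ (d t u) (d t u) = hdot _ u u.
  by have [_ _ ->] := dM t; rewrite -[d' t (d t u)]/((d' t \o d t) u) dK.
(* [c] is the ratio p / n forced by the equations [A0] and [B0] below; its square modulus is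
   13/16. *)
pose z := d cycle3; pose c : C := 4^-1 * (-2 + 3 * 'i%C).
have zE (u : tspace M) : hdot _ (z u) u = c * hdot _ u u.
  set n := hdot _ u u; set p := hdot _ (z u) u; pose q := hdot _ u (z u).
  (* [d (cycle3 * cycle3)] is -(1 + z), and it is isometric at [u]. *)
  have A0 : n + p + q = 0.
    have e : d (cycle3 * cycle3)%g u = - (u + z u).
      have := rel 1%g cycle3 (cycle3 * cycle3)%g 1 1 1 u.
      rewrite d1 !scale1r addrC => /(_ _)/eqP; rewrite addr_eq0 => h; apply/eqP/h => k.
      by rewrite !mul1r perm1 vec3_cycle.
    have := iso (cycle3 * cycle3)%g u; rewrite e hdotNl hdotNr opprK.
    rewrite hdotDl !hdotDr (iso cycle3) -/n -/p -/q => /eqP; rewrite -subr_eq0 => /eqP <-.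
    ring.
  (* The same for [d swap3], which is (2 + i) + 2i z. *)
  have B0 : (2 + 'i%C) * ((2 - 'i%C) * n + - (2 * 'i%C) * q) +
      2 * 'i%C * ((2 - 'i%C) * p + - (2 * 'i%C) * n) - n = 0.
    have e : d swap3 u = (2 + 'i%C) *: u + (2 * 'i%C) *: z u.
      have := rel 1%g cycle3 swap3 (2 + 'i%C) (2 * 'i%C) (-1) u.
      rewrite d1 scaleN1r => /(_ _)/eqP; rewrite subr_eq0 eq_sym => h; apply/eqP/h => k.
      by rewrite perm1 mulN1r vec3_swap.
    have := iso swap3 u; rewrite e !hdotDl !hdotDr !hdotZl !hdotZr.
    rewrite (iso cycle3) -/n -/p -/q rmorphD rmorphM/= imagC_conj rmorph_nat => /eqP.
    rewrite -subr_eq0 => /eqP <-.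
    ring.
  apply/eqP; rewrite -subr_eq0 /c.
  (* Eliminating q, B0 - (2 - 4i) A0 reduces to 8i p + (6 + 4i) n, and -i/8 is the inverse of 8i.
     The last summand, a multiple of i^2 + 1, makes this an identity in an indeterminate ['i]. *)
  have -> : p - 4^-1 * (-2 + 3 * 'i%C) * n =
    - 'i%C / 8 * (((2 + 'i%C) * ((2 - 'i%C) * n + - (2 * 'i%C) * q) +
      2 * 'i%C * ((2 - 'i%C) * p + - (2 * 'i%C) * n) - n) -
      (2 - 4 * 'i%C) * (n + p + q)) +
    ('i%C * 'i%C + 1) * ((1 - 'i%C / 4) * p - 'i%C / 4 * q + (2^-1 - 5 * 'i%C / 8) * n).
    by field.
  by rewrite A0 B0 imagC_sqr addNr mulr0 subr0 mulr0 mul0r addr0.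
have zc : z = c *: idfun.
  have [Mz _ _] := dM cycle3.
  apply: quad_form_inj; [exact: (vN_linear (tcarrierP M) Mz)| |].
    exact: (vN_linear (tcarrierP M) (vNZ (tcarrierP M) c (vN_id (tcarrierP M)))).
  by move=> u; rewrite zE hdotZl.
(* As z = c is isometric and |c|^2 - 1 = -3/16 is nonzero, every vector vanishes, so the identity is
   0 and cannot have trace 1. *)
have : ttrace (idfun : op M) = 0%E.
  have -> : (idfun : op M) = 0; last exact: ttrace0.
  apply/funext => u; apply: hdot_eq0; have := iso cycle3 u.
  rewrite -/z zc hdotZl hdotZr mulrA => /eqP; rewrite -subr_eq0 -[X in _ - X]mul1r -mulrBl.
  rewrite mulf_eq0 => /orP[|/eqP//].
  have -> : c * c^*%R - 1 = - (3 / 16).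
    rewrite /c rmorphM rmorphD rmorphM rmorphN/= fmorphV !rmorph_nat imagC_conj.
    have -> : 4^-1 * (-2 + 3 * 'i%C) * (4^-1 * (-2 + 3 * - 'i%C)) - 1 =
      4^-1 * 4^-1 * (4 - 9 * ('i%C * 'i%C)) - 1 :> C by ring.
    by rewrite imagC_sqr; field.
  by rewrite oppr_eq0 mulf_eq0 invr_eq0 !pnatr_eq0.
by rewrite tr1 => /eqP; rewrite onee_eq0.
Qed.

End SymmetricGroup.

Theorem theorem5p3 (R : realType) :
  exists u : 'S_3 -> R[i],
    [/\ unital (fourier_mul u),
        completely_positive (VN_alg R 'S_3) (fourier_mul u) &
        ~ admits_absolute_dilation (fourier_mul u)].
Proof.
exists (@symbol3 R); split.
- exact/fourier_mul_unital/symbol3_1.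
- apply: (@fourier_mul_cp R 'S_3 'I_3 (fun k (s : 'S_3) => 2^-1 * vec3 R (s^-1%g k))).
  exact: symbol3_kraus.
- exact: symbol3_not_dilatable.
Qed.
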